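(* The set of real border rank-three $2\times2\times2$ hypermatrices, $$\{A\in\mathbb{R}^{2\times2\times2}:\overline{\operatorname{rank}}(A)=3\},$$ has four connected components.
   Context: $\mathbb{R}^{2\times2\times2}$ is identified with $\mathbb{R}^2\otimes\mathbb{R}^2\otimes\mathbb{R}^2$ with its Euclidean topology. $\operatorname{rank}(A)$ is the least $r\in\{0,1,2,\dots\}$ such that $A=\sum_{i=1}^r u_i\otimes v_i\otimes w_i$ with $u_i,v_i,w_i\in\mathbb{R}^2$. The (real) border rank $\overline{\operatorname{rank}}(A)$ is the least $r$ such that $A$ lies in the Euclidean closure of $\{B\in\mathbb{R}^{2\times2\times2}:\operatorname{rank}(B)\le r\}$. *)

(* Defs.v *)
From mathcomp Require Import all_boot all_order all_algebra.
From mathcomp Require Import all_classical all_reals all_analysis.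

Set Implicit Arguments.
Unset Strict Implicit.
Unset Printing Implicit Defensive.

Import Order.TTheory GRing.Theory Num.Theory.
Import numFieldNormedType.Exports.
Local Open Scope classical_set_scope.
Local Open Scope ring_scope.

(* [ptws] is the product topology of the eight coordinates, i.e. the
   Euclidean topology on R^(2 x 2 x 2). *)
Notation hypermatrix R := {ptws 'I_2 * 'I_2 * 'I_2 -> Real.sort R}.

Definition has_decomp (R : realType) (A : hypermatrix R) (r : nat) : Prop :=
  exists u v w : 'I_r -> 'rV[R]_2,
    forall i j k : 'I_2,
      A (i, j, k) = \sum_(l < r) u l 0 i * v l 0 j * w l 0 k.

Lemma has_decomp_ex (R : realType) (A : hypermatrix R) :
  exists r, `[< has_decomp A r >].
Proof.
pose T : finType := ('I_2 * 'I_2 * 'I_2)%type.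
exists #|{: T}|; apply/asboolP.
exists (fun l => A (enum_val l) *: delta_mx 0 (enum_val l).1.1).
exists (fun l => delta_mx 0 (enum_val l).1.2).
exists (fun l => delta_mx 0 (enum_val l).2) => i j k.
pose F (t : T) := (A t *: (delta_mx 0 t.1.1 : 'rV[R]_2)) 0 i
  * (delta_mx 0 t.1.2 : 'rV[R]_2) 0 j * (delta_mx 0 t.2 : 'rV[R]_2) 0 k.
rewrite -(big_enum_val F) (bigD1 ((i, j, k) : T)) //= big1 => [|[[a b] c]].
  by rewrite /F !mxE !eqxx !mulr1 addr0.
rewrite /F /= !mxE eqxx /= !xpair_eqE !(eq_sym i) !(eq_sym j) !(eq_sym k).
by case: (a == i); case: (b == j); case: (c == k); rewrite ?mulr0 ?mul0r.
Qed.

Definition rank (R : realType) (A : hypermatrix R) : nat :=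
  ex_minn (has_decomp_ex A).

Lemma border_rank_ex (R : realType) (A : hypermatrix R) :
  exists r, `[< closure [set B : hypermatrix R | (rank B <= r)%N] A >].
Proof. by exists (rank A); apply/asboolP/subset_closure => /=. Qed.

Definition border_rank (R : realType) (A : hypermatrix R) : nat :=
  ex_minn (border_rank_ex A).

Definition components (T : topologicalType) (A : set T) : set (set T) :=
  [set connected_component A x | x in A].

(* Main.v *)
Require Import Defs.
From mathcomp Require Import all_boot all_order all_algebra.
From mathcomp Require Import all_classical all_reals all_analysis.
From mathcomp Require Import ring lra.

Set Implicit Arguments.
Unset Strict Implicit.
Unset Printing Implicit Defensive.

Import Order.TTheory GRing.Theory Num.Theory.
Import numFieldNormedType.Exports.
Local Open Scope classical_set_scope.
Local Open Scope card_scope.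
Local Open Scope ring_scope.

(* The hyperdeterminant is the discriminant of the binary quadratic form
   [q(x, y) = \det (x A_0 + y A_1)], where [A_0] and [A_1] are the two slices of
   [A] along the first index. It is nonnegative on rank at most two. If it is
   positive, then the two real roots of [q] are singular matrices spanning the
   pencil, so that [A] has rank at most two. Along the line through [A] in the
   direction of the unit tensor opposite to a nonzero entry [a], it is a
   quadratic polynomial with leading coefficient [a ^+ 2]; hence it becomes
   positive close to [A] if it vanishes at [A], and far away from [A] if it is
   negative. So border rank three means that the hyperdeterminant is negative.
   There the first slices along the first and along the third index are both
   invertible, and the signs of their determinants cut the set into four open
   pieces. In the orthonormal frame given by the first fibre, the negativity of
   the hyperdeterminant is a bound on a single coordinate, so that each piece is
   a continuous image of R^8. *)

(** * The hyperdeterminant, coordinatewise continuity and rank decompositions *)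

Section Hyperdeterminant.
Variable R : realType.
Implicit Types (A B : hypermatrix R).

(** The digit in [slice1_det] and [slice3_det] names the index held at [0]. *)
Definition slice1_det A : R :=
  A (0, 0, 0) * A (0, 1, 1) - A (0, 0, 1) * A (0, 1, 0).

Definition slice3_det A : R :=
  A (0, 0, 0) * A (1, 1, 0) - A (1, 0, 0) * A (0, 1, 0).

Definition hyperdet A : R :=
  (A (0, 0, 0) * A (1, 1, 1) + A (0, 1, 1) * A (1, 0, 0)
   - A (0, 0, 1) * A (1, 1, 0) - A (0, 1, 0) * A (1, 0, 1)) ^+ 2
  - 4 * slice1_det A * (A (1, 0, 0) * A (1, 1, 1) - A (1, 0, 1) * A (1, 1, 0)).

Lemma ord2P (i : 'I_2) : i = 0 \/ i = 1.
Proof. by case: i => [[|[|//]] ?]; [left|right]; apply/val_inj. Qed.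

Lemma hypermatrixP (P : 'I_2 * 'I_2 * 'I_2 -> Prop) :
  P (0, 0, 0) -> P (0, 0, 1) -> P (0, 1, 0) -> P (0, 1, 1) ->
  P (1, 0, 0) -> P (1, 0, 1) -> P (1, 1, 0) -> P (1, 1, 1) ->
  forall t, P t.
Proof.
move=> ? ? ? ? ? ? ? ? [[i j] k].
by case: (ord2P i) => ->; case: (ord2P j) => ->; case: (ord2P k) => ->.
Qed.

Definition hypermx (a b c d e f g h : R) : hypermatrix R := fun t =>
  if t.1.1 == 0 then
    if t.1.2 == 0 then if t.2 == 0 then a else b else if t.2 == 0 then c else d
  else
    if t.1.2 == 0 then if t.2 == 0 then e else f else if t.2 == 0 then g else h.

Lemma continuous_entry t : continuous (fun A : hypermatrix R => A t).
Proof. exact: (@proj_continuous _ (fun=> R) t). Qed.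

Lemma continuous_hypermatrix (T : topologicalType) (f : T -> hypermatrix R) :
  (forall t, continuous (fun x => f x t)) -> continuous f.
Proof.
move=> fc x; apply/cvg_sup => t; exact: (continuous_comp_initial (fc t)).
Qed.

Lemma continuous_add (T : topologicalType) (f g : T -> R) :
  continuous f -> continuous g -> continuous (fun x => f x + g x).
Proof. move=> cf cg x; exact: (cvgD (cf x) (cg x)). Qed.

Lemma continuous_sub (T : topologicalType) (f g : T -> R) :
  continuous f -> continuous g -> continuous (fun x => f x - g x).
Proof. move=> cf cg x; exact: (cvgB (cf x) (cg x)). Qed.

Lemma continuous_mul (T : topologicalType) (f g : T -> R) :
  continuous f -> continuous g -> continuous (fun x => f x * g x).
Proof. move=> cf cg x; exact: (cvgM (cf x) (cg x)). Qed.

Lemma continuous_entry2 s t : continuous (fun A : hypermatrix R => A s * A t).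
Proof. exact: (continuous_mul (@continuous_entry s) (@continuous_entry t)). Qed.

Lemma continuous_minor s t u v :
  continuous (fun A : hypermatrix R => A s * A t - A u * A v).
Proof.
exact: (continuous_sub (@continuous_entry2 s t) (@continuous_entry2 u v)).
Qed.

Lemma continuous_hyperdet : continuous hyperdet.
Proof.
have q := @continuous_entry2; have m := @continuous_minor.
have p := continuous_sub (continuous_sub
  (continuous_add (q (0, 0, 0) (1, 1, 1)) (q (0, 1, 1) (1, 0, 0)))
  (q (0, 0, 1) (1, 1, 0))) (q (0, 1, 0) (1, 0, 1)).
have c4 : continuous (fun _ : hypermatrix R => 4 : R) by exact: cst_continuous.
exact: (continuous_sub (continuous_mul p p) (continuous_mul
  (continuous_mul c4 (m (0, 0, 0) (0, 1, 1) (0, 0, 1) (0, 1, 0)))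
  (m (1, 0, 0) (1, 1, 1) (1, 0, 1) (1, 1, 0)))).
Qed.

Lemma has_decomp0 A : (forall t, A t = 0) -> has_decomp A 0.
Proof.
by move=> A0; exists (fun=> 0), (fun=> 0), (fun=> 0) => i j k; rewrite big_ord0.
Qed.

Lemma has_decompS A B r (u v w : 'rV[R]_2) : has_decomp A r ->
  (forall i j k, B (i, j, k) = u 0 i * v 0 j * w 0 k + A (i, j, k)) ->
  has_decomp B r.+1.
Proof.
move=> [us [vs [ws As]]] BA.
pose ext (x : 'rV[R]_2) xs (l : 'I_r.+1) := oapp xs x (unlift ord0 l).
exists (ext u us), (ext v vs), (ext w ws) => i j k.
rewrite big_ord_recl BA As /ext unlift_none /=; congr (_ + _).
by apply: eq_bigr => l _; rewrite liftK.
Qed.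

Lemma rank_leP A r : reflect (has_decomp A r) (rank A <= r)%N.
Proof.
rewrite /rank; case: ex_minnP => m /asboolP Am m_min.
apply: (iffP idP) => [mr|/asboolP/m_min//].
(* A shorter decomposition is padded with zero terms. *)
rewrite -(subnKC mr); elim: (r - m)%N => [|n IHn]; first by rewrite addn0.
rewrite addnS; apply: (has_decompS (u := 0) (v := 0) (w := 0) IHn) => i j k.
by rewrite !mxE !mul0r add0r.
Qed.

Lemma border_rank_leP A r :
  reflect (closure [set B : hypermatrix R | (rank B <= r)%N] A)
          (border_rank A <= r)%N.
Proof.
rewrite /border_rank; case: ex_minnP => m /asboolP Am m_min.
apply: (iffP idP) => [mr|/asboolP/m_min//].
by apply: closureS Am => B /= /leq_trans; apply.
Qed.

(* A sum of two rank-one tensors with factors [U], [V], [W] has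
   hyperdeterminant [(\det U * \det V * \det W) ^+ 2]. *)
Lemma hyperdet_ge0 A : (rank A <= 2)%N -> 0 <= hyperdet A.
Proof.
move=> /rank_leP[u [v [w Auvw]]].
rewrite /hyperdet /slice1_det !Auvw !big_ord_recl !big_ord0 !addr0.
set x := lift _ _.
pose d (y : 'I_2 -> 'rV[R]_2) := y ord0 0 0 * y x 0 1 - y ord0 0 1 * y x 0 0.
rewrite [leRHS](_ : _ = (d u * d v * d w) ^+ 2) ?sqr_ge0// /d; ring.
Qed.

End Hyperdeterminant.

(** * Border rank three as negativity of the hyperdeterminant *)

Section BorderRank.
Variable R : realType.
Implicit Types (A B : hypermatrix R).

Definition row2 (a b : R) : 'rV[R]_2 := \row_j (if j == 0 then a else b).

(** If [a] is nonzero, the second row is [c / a] times the first. Otherwise [b * c = 0], so the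
    first row or the first column vanishes. *)
Lemma minor_eq0_factor (a b c d : R) : a * d = b * c ->
  exists v w : 'rV[R]_2, forall j k, v 0 j * w 0 k =
    if j == 0 then if k == 0 then a else b else if k == 0 then c else d.
Proof.
have [-> | a0] := eqVneq a 0; last first.
  move=> adbc; exists (row2 1 (c / a)), (row2 a b) => j k; rewrite !mxE.
  have -> : d = c / a * b.
    by rewrite mulrAC [c * b]mulrC -adbc mulrAC divff// mul1r.
  by case: (j == 0); case: (k == 0); rewrite ?mul1r// divfK.
have [-> | b0] := eqVneq b 0.
  exists (row2 0 1), (row2 c d) => j k; rewrite !mxE.
  by case: (j == 0); case: (k == 0); rewrite ?mul1r ?mul0r.
rewrite mul0r => /esym/eqP; rewrite mulf_eq0 (negPf b0) /= => /eqP ->.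
exists (row2 1 (d / b)), (row2 0 b) => j k; rewrite !mxE.
by case: (j == 0); case: (k == 0); rewrite ?mul1r ?mulr0// divfK.
Qed.

Lemma hyperdet_gt0_rank A : 0 < hyperdet A -> (rank A <= 2)%N.
Proof.
set m := A (0, 0, 0) * A (1, 1, 1) + A (0, 1, 1) * A (1, 0, 0)
   - A (0, 0, 1) * A (1, 1, 0) - A (0, 1, 0) * A (1, 0, 1).
set d0 := slice1_det A.
set d1 := A (1, 0, 0) * A (1, 1, 1) - A (1, 0, 1) * A (1, 1, 0).
move=> A_gt0.
have [s sE ps0] : exists2 s, s ^+ 2 = hyperdet A & (m + s) * s != 0.
  have r_gt0 : 0 < Num.sqrt (hyperdet A) by rewrite sqrtr_gt0.
  have rE := sqr_sqrtr (ltW A_gt0).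
  have [m0|m0] := leP 0 m.
    exists (Num.sqrt (hyperdet A)) => //.
    by rewrite gt_eqF// mulr_gt0// ltr_wpDl.
  exists (- Num.sqrt (hyperdet A)); first by rewrite sqrrN.
  by rewrite mulrN -mulNr opprB gt_eqF// mulr_gt0// subr_gt0 (lt_trans m0).
(* [(- p, 2 d0)] and [(2 d1, - p)] are the two roots of [q]; the sign of [s] is
   chosen so that they stay independent when [d0] or [d1] vanishes. *)
pose p := m + s; pose D := p ^+ 2 - 4 * d0 * d1.
have D0 : D != 0.
  have -> : D = 2 * (p * s).
    have -> : D = p ^+ 2 - (m ^+ 2 - hyperdet A).
      by rewrite /D /hyperdet -/m -/d0 -/d1; ring.
    by rewrite -sE /p; ring.
  by rewrite mulf_neq0 ?pnatr_eq0.
have dE : m ^+ 2 - 4 * d0 * d1 = s ^+ 2 by rewrite sE.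
pose B1 j k := - p * A (0, j, k) + 2 * d0 * A (1, j, k).
pose B2 j k := 2 * d1 * A (0, j, k) - p * A (1, j, k).
have [v1 [w1 E1]] : exists v w : 'rV[R]_2, forall j k, v 0 j * w 0 k = B1 j k.
  have [|v [w E]] := @minor_eq0_factor (B1 0 0) (B1 0 1) (B1 1 0) (B1 1 1).
    (* The determinant of [B1] is [q (- p, 2 d0) = d0 * ((p - m) ^+ 2 - s ^+ 2)], which vanishes
       since [p = m + s]; similarly for [B2] with [d1]. *)
    apply/eqP; rewrite -subr_eq0; apply/eqP.
    have -> : B1 0 0 * B1 1 1 - B1 0 1 * B1 1 0 =
      p ^+ 2 * d0 - 2 * d0 * p * m + 4 * d0 ^+ 2 * d1.
      by rewrite /B1 /d0 /slice1_det /d1 /m; ring.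
    have -> : 4 * d0 ^+ 2 * d1 = d0 * (m ^+ 2 - s ^+ 2) by rewrite -dE; ring.
    by rewrite /p; ring.
  exists v, w => j k; rewrite E.
  by case: (ord2P j) => ->; case: (ord2P k) => ->.
have [v2 [w2 E2]] : exists v w : 'rV[R]_2, forall j k, v 0 j * w 0 k = B2 j k.
  have [|v [w E]] := @minor_eq0_factor (B2 0 0) (B2 0 1) (B2 1 0) (B2 1 1).
    apply/eqP; rewrite -subr_eq0; apply/eqP.
    have -> : B2 0 0 * B2 1 1 - B2 0 1 * B2 1 0 =
      p ^+ 2 * d1 - 2 * d1 * p * m + 4 * d1 ^+ 2 * d0.
      by rewrite /B2 /d0 /slice1_det /d1 /m; ring.
    have -> : 4 * d1 ^+ 2 * d0 = d1 * (m ^+ 2 - s ^+ 2) by rewrite -dE; ring.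
    by rewrite /p; ring.
  exists v, w => j k; rewrite E.
  by case: (ord2P j) => ->; case: (ord2P k) => ->.
(* [u1] and [u2] are the columns of the inverse of the matrix whose rows are the two roots and whose
   determinant is [D]; they express the slices through [B1] and [B2]. *)
pose u1 := row2 (- p / D) (- (2 * d1) / D).
pose u2 := row2 (- (2 * d0) / D) (- p / D).
pose Z : hypermatrix R := fun=> 0.
pose A2 : hypermatrix R := fun t => u2 0 t.1.1 * v2 0 t.1.2 * w2 0 t.2 + Z t.
apply/rank_leP; apply: (@has_decompS _ A2 _ _ u1 v1 w1).
  apply: (@has_decompS _ Z _ _ u2 v2 w2) => //; exact: has_decomp0.
move=> i j k; rewrite /A2 /Z /= addr0 -!mulrA E1 E2 /u1 /u2 !mxE /B1 /B2.
have DK x y : D * (x / D * y) = x * y by rewrite mulrA mulrCA divff// mulr1.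
by case: (ord2P i) => -> /=; apply: (mulfI D0); rewrite mulrDr !DK /D; ring.
Qed.

(** The square of an entry occurs in the hyperdeterminant only multiplied by the square of the
    opposite entry. *)
Lemma hyperdet_perturb A t :
  exists (u v w : 'rV[R]_2) (b : R), forall x,
    hyperdet (fun i => A i + x * (u 0 i.1.1 * v 0 i.1.2 * w 0 i.2)) =
    hyperdet A + x * b + x ^+ 2 * A t ^+ 2.
Proof.
(* Adding [1] in ['I_2] flips an index. *)
exists (delta_mx 0 (t.1.1 + 1)), (delta_mx 0 (t.1.2 + 1)).
exists (delta_mx 0 (t.2 + 1)).
pose E : hypermatrix R :=
  fun i => (i == (t.1.1 + 1, t.1.2 + 1, t.2 + 1))%:R.
(* The linear coefficient is read off at [x = 1]. *)
exists (hyperdet (fun i => A i + E i) - hyperdet A - A t ^+ 2) => x.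
rewrite /E {E} /hyperdet /slice1_det !mxE.
by move: t; apply: hypermatrixP; rewrite /=; ring.
Qed.

(** One of [y] and [- y] makes the linear term nonnegative. Fixing [|x|] allows steps both
    arbitrarily small and large. *)
Lemma quadratic_gt0 (c b p y : R) : 0 < y -> 0 < c + y ^+ 2 * p ->
  exists2 x, `|x| = y & 0 < c + x * b + x ^+ 2 * p.
Proof.
move=> y0 cp; have [b0|b0] := leP 0 b.
  exists y; first exact: gtr0_norm.
  by rewrite addrAC ltr_wpDr// mulr_ge0// ltW.
exists (- y); first by rewrite normrN gtr0_norm.
by rewrite sqrrN addrAC ltr_wpDr// mulr_le0 ?oppr_le0// ltW.
Qed.

Lemma hyperdet_neq0_entry A : hyperdet A != 0 -> exists t, A t != 0.
Proof.
move=> A0; apply/existsP; apply: contraNT A0 => /existsPn/= A0.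
have Az t : A t = 0 by apply/eqP; rewrite -[_ == _]negbK.
by rewrite /hyperdet /slice1_det !Az; apply/eqP; ring.
Qed.

Lemma hyperdet_lt0_rank A : hyperdet A < 0 -> (rank A <= 3)%N.
Proof.
move=> A_lt0; have /ltr0_neq0/hyperdet_neq0_entry[t At] := A_lt0.
have [u [v [w [b AE]]]] := hyperdet_perturb A t.
have p0 : 0 < A t ^+ 2 by rewrite exprn_even_gt0.
set q := hyperdet A / A t ^+ 2.
have q0 : q < 0 by rewrite pmulr_llt0 ?invr_gt0.
(* With [y = 1 - q], the value without linear term is [(q + y ^+ 2) * A t ^+ 2], and
   [q + (1 - q) ^+ 2 = 1 - q + q ^+ 2] is positive. *)
have y0 : 0 < 1 - q by rewrite subr_gt0 (lt_trans q0).
have [|x _] := @quadratic_gt0 (hyperdet A) b (A t ^+ 2) _ y0.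
  rewrite -[hyperdet A](divfK (lt0r_neq0 p0)) -/q -mulrDl mulr_gt0//; nra.
rewrite -AE => /hyperdet_gt0_rank/rank_leP r2.
apply/rank_leP; apply: (has_decompS (u := (- x) *: u) (v := v) (w := w) r2).
by move=> i j k /=; rewrite !mxE; ring.
Qed.

Lemma hyperdet_ge0_border_rank A : 0 <= hyperdet A -> (border_rank A <= 2)%N.
Proof.
move=> A_ge0; apply/border_rank_leP.
have [[t At]|A0] := pselect (exists t, A t != 0); last first.
  apply: subset_closure => /=; apply/rank_leP.
  have Az t : A t = 0 by apply: contra_notP A0 => /eqP ?; exists t.
  exists (fun=> 0), (fun=> 0), (fun=> 0) => i j k.
  by rewrite Az big1// => l _; rewrite mxE !mul0r.
have [u [v [w [b AE]]]] := hyperdet_perturb A t.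
pose f (x : R) : hypermatrix R :=
  fun i => A i + x * (u 0 i.1.1 * v 0 i.1.2 * w 0 i.2).
have fc : continuous f.
  apply: continuous_hypermatrix => i; apply: continuous_add.
    exact: cst_continuous.
  by apply: continuous_mul; [move=> ?; exact: cvg_id|exact: cst_continuous].
have f0 : f 0 = A by apply/funext => i; rewrite /f mul0r addr0.
move=> U; rewrite -f0 => /fc/nbhs_ballP[e /= e0 eU].
(* A step of size [e / 2] stays in the ball whichever sign [quadratic_gt0] selects. *)
have e20 : 0 < e / 2 by rewrite divr_gt0.
have p0 : 0 < (e / 2) ^+ 2 * A t ^+ 2.
  by rewrite mulr_gt0// exprn_even_gt0//= gt_eqF.
have [|x xe] := @quadratic_gt0 (hyperdet A) b (A t ^+ 2) _ e20.
  by rewrite ltr_wpDl.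
rewrite -AE => /hyperdet_gt0_rank fx2; exists (f x); split => //.
by apply: eU; rewrite /ball/= sub0r normrN xe; lra.
Qed.

Lemma border_rank3P A : (border_rank A = 3%N) <-> hyperdet A < 0.
Proof.
split=> [A3|A_lt0].
  rewrite ltNge; apply/negP => /hyperdet_ge0_border_rank.
  by rewrite A3.
apply/eqP; rewrite eqn_leq; apply/andP; split.
  by apply/border_rank_leP/subset_closure/hyperdet_lt0_rank.
rewrite ltnNge; apply/negP => /border_rank_leP clA.
(* Nonnegativity is a closed condition, so it passes from rank at most two to the closure. *)
suff : 0 <= hyperdet A by rewrite leNgt A_lt0.
have cl : closed (@hyperdet R @^-1` [set x | 0 <= x]).
  by apply: closed_comp (@closed_ge _ 0) => B _; exact: continuous_hyperdet.
by apply: cl; apply: closureS clA => B /= /hyperdet_ge0.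
Qed.

End BorderRank.

(** * Counting components of an open partition, and angles on the unit circle *)

Lemma card_components_open_partition (T : topologicalType) (A : set T) n
    (F : nat -> set T) :
  A = \bigcup_(k in `I_n) F k -> trivIset `I_n F ->
  (forall k, (k < n)%N -> [/\ open (F k), connected (F k) & F k !=set0]) ->
  components A #= `I_n.
Proof.
move=> AE tF FP.
have compE k x : (k < n)%N -> F k x -> connected_component A x = F k.
  move=> kn Fkx; have [Fko Fkc _] := FP k kn.
  have FkA : F k `<=` A by move=> y Fky; rewrite AE; exists k.
  apply/seteqP; split; last exact: connected_component_max.
  (* The piece [F k] is open, and closed relative to [A] because the other pieces are open; so it
     cuts no component. *)
  suff <- : connected_component A x `&` F k = connected_component A x.
    exact: subIsetr.
  apply: component_connected.
  - by exists x; split => //; exact: connected_component_refl (FkA _ Fkx).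
  - by exists (F k).
  - exists (~` \bigcup_(j in `I_n `\ k) F j).
      apply/open_closedC/bigcup_open => j [/= jn _]; by have [] := FP j jn.
    apply/seteqP; split=> y [Cy Hy]; split=> //.
      move=> [j [/= jn jk] Fjy]; apply: jk; apply: tF => //; by exists y.
    have := connected_component_sub Cy; rewrite AE => -[j /= jn Fjy].
    have [<-//|/eqP jk] := eqVneq j k.
    by exfalso; apply: Hy; exists j.
have -> : components A = F @` `I_n.
  apply/seteqP; split=> [_ [x Ax <-]|_ [k kn <-]].
    have := Ax; rewrite {1}AE => -[k kn Fkx].
    by exists k => //; rewrite (compE k).
  have [_ _ [x Fkx]] := FP k kn.
  by exists x; [rewrite AE; exists k|exact: compE].
(* Pieces are nonempty, so two equal pieces meet and have the same index. *)
apply: inj_card_eq => i j; rewrite !inE => ni nj FE.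
by apply: tF => //; rewrite -FE setIid; have [] := FP i ni.
Qed.

Lemma cos_sin_surj (R : realType) (x y : R) : x ^+ 2 + y ^+ 2 = 1 ->
  exists2 a, cos a = x & sin a = y.
Proof.
move=> xy1.
have x1 : -1 <= x <= 1.
  rewrite -ler_norml -sqrtr_sqr -[leRHS]sqrtr1 ler_wsqrtr//.
  by rewrite -xy1 lerDl sqr_ge0.
have xyE : 1 - x ^+ 2 = y ^+ 2 by rewrite -xy1 addrC addKr.
have sE := sin_acos x1; rewrite xyE sqrtr_sqr in sE.
have cE : cos (acos x) = x by rewrite acosK// in_itv.
have [y0|y0] := leP 0 y; first by exists (acos x) => //; rewrite sE ger0_norm.
by exists (- acos x); rewrite ?cosN// sinN sE ltr0_norm ?opprK.
Qed.

(** * The four sign classes, their charts and their connectedness *)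

Section SignClasses.
Variable R : realType.
Implicit Types (A B : hypermatrix R).

(** The signs are real factors, so that a single chart, with fibres scaled by them, serves all four
    classes. *)
Definition sign_class (s1 s2 : R) : set (hypermatrix R) :=
  [set A | [/\ hyperdet A < 0, 0 < s1 * slice1_det A & 0 < s2 * slice3_det A]].

Lemma open_sign_class s1 s2 : open (sign_class s1 s2).
Proof.
rewrite (_ : sign_class _ _ = @hyperdet R @^-1` [set x | x < 0] `&`
  ((fun A => s1 * slice1_det A) @^-1` [set x | 0 < x] `&`
   (fun A => s2 * slice3_det A) @^-1` [set x | 0 < x])); last first.
  by apply/seteqP; split=> [A []|A [? []]].
have c (s : R) : continuous (fun _ : hypermatrix R => s).
  exact: cst_continuous.
apply: openI; last apply: openI.
- by apply: open_comp (@open_lt _ 0) => B _; exact: continuous_hyperdet.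
- apply: open_comp (@open_gt _ 0) => B _.
  exact: (continuous_mul (c s1) (@continuous_minor R _ _ _ _)).
- apply: open_comp (@open_gt _ 0) => B _.
  exact: (continuous_mul (c s2) (@continuous_minor R _ _ _ _)).
Qed.

Section Frame.
Variables s1 s2 : R.
Hypotheses (s1E : s1 ^+ 2 = 1) (s2E : s2 ^+ 2 = 1).

(* The four fibres of a hypermatrix along the second index, in the orthonormal
   frame [(x, y)], [(- y, x)]; the first one is a multiple of [(x, y)]. *)
Definition framed (x y r al be ga de ep ze : R) : hypermatrix R :=
  hypermx (r * x) (s1 * (al * x - be * y))
          (r * y) (s1 * (al * y + be * x))
          (s2 * (ga * x - de * y)) (s1 * s2 * (ep * x - ze * y))
          (s2 * (ga * y + de * x)) (s1 * s2 * (ep * y + ze * x)).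

Lemma slice1_det_framed x y r al be ga de ep ze : x ^+ 2 + y ^+ 2 = 1 ->
  s1 * slice1_det (framed x y r al be ga de ep ze) = r * be.
Proof.
move=> xy1; rewrite /slice1_det /framed /hypermx /=.
transitivity (s1 ^+ 2 * (x ^+ 2 + y ^+ 2) * (r * be)); first by ring.
by rewrite s1E xy1 !mul1r.
Qed.

Lemma slice3_det_framed x y r al be ga de ep ze : x ^+ 2 + y ^+ 2 = 1 ->
  s2 * slice3_det (framed x y r al be ga de ep ze) = r * de.
Proof.
move=> xy1; rewrite /slice3_det /framed /hypermx /=.
transitivity (s2 ^+ 2 * (x ^+ 2 + y ^+ 2) * (r * de)); first by ring.
by rewrite s2E xy1 !mul1r.
Qed.

(** The right-hand side is affine in [ep] with slope [4 * r * be * de]. Where this is positive, a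
    negative hyperdeterminant amounts to an upper bound on [ep]. *)
Lemma hyperdet_framed x y r al be ga de ep ze : x ^+ 2 + y ^+ 2 = 1 ->
  hyperdet (framed x y r al be ga de ep ze) =
  (r * ze + ga * be - al * de) ^+ 2 - 4 * (r * be) * (ga * ze - ep * de).
Proof.
move=> xy1; rewrite /hyperdet /slice1_det /framed /hypermx /=.
set rhs := RHS.
(* Inserting factors equal to [1] turns the claim into a polynomial identity. *)
transitivity (s1 ^+ 2 * s2 ^+ 2 * (x ^+ 2 + y ^+ 2) ^+ 2 * rhs).
  by rewrite /rhs; ring.
by rewrite s1E s2E xy1 expr1n !mul1r.
Qed.

Lemma sign_class_framed A : sign_class s1 s2 A ->
  exists x y r al be ga de ep ze, [/\ x ^+ 2 + y ^+ 2 = 1, 0 < r, 0 < be,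
    0 < de & A = framed x y r al be ga de ep ze].
Proof.
case=> _ A1 A3.
pose v0 := A (0, 0, 0); pose v1 := A (0, 1, 0).
have v_neq0 : v0 ^+ 2 + v1 ^+ 2 != 0.
  (* If the first fibre vanished, so would [slice1_det A]. *)
  apply: contraTneq A1 => /eqP.
  rewrite paddr_eq0 ?sqr_ge0// !sqrf_eq0 => /andP[/eqP v00 /eqP v10].
  by rewrite /slice1_det -/v0 -/v1 v00 v10 mul0r mulr0 subr0 mulr0 ltxx.
pose r := Num.sqrt (v0 ^+ 2 + v1 ^+ 2).
have r_gt0 : 0 < r by rewrite sqrtr_gt0 lt0r v_neq0 addr_ge0// sqr_ge0.
have r_neq0 := lt0r_neq0 r_gt0.
have r2 : r ^+ 2 = v0 ^+ 2 + v1 ^+ 2 by rewrite sqr_sqrtr// addr_ge0// sqr_ge0.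
pose x := v0 / r; pose y := v1 / r.
have xy1 : x ^+ 2 + y ^+ 2 = 1.
  by rewrite /x /y !expr_div_n -mulrDl -r2 divff// expf_neq0.
have rx : r * x = v0 by rewrite mulrC divfK.
have ry : r * y = v1 by rewrite mulrC divfK.
(* Inner products and determinants with [(x, y)] give the frame coordinates; each sign is its own
   inverse. *)
pose al := s1 * (A (0, 0, 1) * x + A (0, 1, 1) * y).
pose be := s1 * (x * A (0, 1, 1) - y * A (0, 0, 1)).
pose ga := s2 * (A (1, 0, 0) * x + A (1, 1, 0) * y).
pose de := s2 * (x * A (1, 1, 0) - y * A (1, 0, 0)).
pose ep := s1 * s2 * (A (1, 0, 1) * x + A (1, 1, 1) * y).
pose ze := s1 * s2 * (x * A (1, 1, 1) - y * A (1, 0, 1)).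
have AE : A = framed x y r al be ga de ep ze.
  apply/funext; have k1 z : z = s1 ^+ 2 * (x ^+ 2 + y ^+ 2) * z.
    by rewrite s1E xy1 !mul1r.
  have k2 z : z = s2 ^+ 2 * (x ^+ 2 + y ^+ 2) * z by rewrite s2E xy1 !mul1r.
  have k12 z : z = s1 ^+ 2 * s2 ^+ 2 * (x ^+ 2 + y ^+ 2) * z.
    by rewrite s1E s2E xy1 !mul1r.
  rewrite /framed /hypermx; apply: hypermatrixP => /=; rewrite ?rx ?ry //.
  - by rewrite /al /be [LHS]k1; ring.
  - by rewrite /al /be [LHS]k1; ring.
  - by rewrite /ga /de [LHS]k2; ring.
  - by rewrite /ep /ze [LHS]k12; ring.
  - by rewrite /ga /de [LHS]k2; ring.
  - by rewrite /ep /ze [LHS]k12; ring.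
exists x, y, r, al, be, ga, de, ep, ze; split => //.
- by move: A1; rewrite AE slice1_det_framed// pmulr_rgt0.
- by move: A3; rewrite AE slice3_det_framed// pmulr_rgt0.
Qed.

(* The last parameter is [ln (- hyperdet)], which determines [ep]. *)
Definition chart (p : nat -> R) : hypermatrix R :=
  let: (r, be, de) := (expR (p 1%N), expR (p 2), expR (p 3)) in
  let: (al, ga, ze) := (p 4, p 5, p 6) in
  let m := r * ze + ga * be - al * de in
  let ep := (4 * (r * be) * (ga * ze) - m * m - expR (p 7))
            * (4^-1 * expR (- (p 1%N + p 2 + p 3))) in
  framed (cos (p 0%N)) (sin (p 0%N)) r al be ga de ep ze.

(** The factor [4^-1 * expR (- (p 1 + p 2 + p 3))] inverts the slope in [ep], so the
    hyperdeterminant of the chart is [- expR (p 7)]. *)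
Lemma chart_sign_class p : sign_class s1 s2 (chart p).
Proof.
have cs := cos2Dsin2 (p 0%N).
split; rewrite ?slice1_det_framed ?slice3_det_framed ?mulr_gt0 ?expR_gt0//.
rewrite hyperdet_framed// expRN !expRD.
have [[r0 b0] d0] := (expR_gt0 (p 1%N), expR_gt0 (p 2), expR_gt0 (p 3)).
rewrite [ltLHS](_ : _ = - expR (p 7)) ?oppr_lt0 ?expR_gt0//.
by field; rewrite ?lt0r_neq0.
Qed.

Lemma sign_class_chart A : sign_class s1 s2 A -> exists p, A = chart p.
Proof.
move=> cA; have [A_lt0 _ _] := cA.
have [x [y [r [al [be [ga [de [ep [ze [xy1 r0 be0 de0 AE]]]]]]]]]] :=
  sign_class_framed cA.
have [a ax ay] := cos_sin_surj xy1.
exists (nth 0 [:: a; ln r; ln be; ln de; al; ga; ze; ln (- hyperdet A)]).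
rewrite /chart/= expRN !expRD !lnK ?posrE ?oppr_gt0// ax ay {1}AE.
(* Only [ep] remains; it is recovered from the value of the hyperdeterminant. *)
congr framed; rewrite AE hyperdet_framed//.
by field; rewrite ?lt0r_neq0.
Qed.

Lemma continuous_chart (T : topologicalType) (p : nat -> T -> R) :
  (forall i, continuous (p i)) -> continuous (fun t => chart (p ^~ t)).
Proof.
move=> pc.
have c (a : R) : continuous (fun _ : T => a) by exact: cst_continuous.
have ec (f : T -> R) : continuous f -> continuous (fun t => expR (f t)).
  by move=> fc t; apply: continuous_comp; [exact: fc|exact: continuous_expR].
have cc : continuous (fun t => cos (p 0%N t)).
  by move=> t; apply: continuous_comp; [exact: pc|exact: continuous_cos].
have sc : continuous (fun t => sin (p 0%N t)).
  by move=> t; apply: continuous_comp; [exact: pc|exact: continuous_sin].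
have D := @continuous_add R T; have B := @continuous_sub R T.
have M := @continuous_mul R T.
have [[rc bc] dc] := (ec _ (pc 1%N), ec _ (pc 2), ec _ (pc 3)).
have qc := ec _ (pc 7).
have [[ac gc] zc] := (pc 4, pc 5, pc 6).
have mc := B _ _ (D _ _ (M _ _ rc zc) (M _ _ gc bc)) (M _ _ ac dc).
have ic : continuous (fun t => expR (- (p 1%N t + p 2 t + p 3 t))).
  apply: ec => t; apply: cvgN; exact: (D _ _ (D _ _ (pc 1%N) (pc 2)) (pc 3)).
have rbgzc := M _ _ (M _ _ (c 4) (M _ _ rc bc)) (M _ _ gc zc).
have epc := M _ _ (B _ _ (B _ _ rbgzc (M _ _ mc mc)) qc) (M _ _ (c 4^-1) ic).
apply: continuous_hypermatrix; apply: hypermatrixP.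
- exact: (M _ _ rc cc).
- exact: (M _ _ (c s1) (B _ _ (M _ _ ac cc) (M _ _ bc sc))).
- exact: (M _ _ rc sc).
- exact: (M _ _ (c s1) (D _ _ (M _ _ ac sc) (M _ _ bc cc))).
- exact: (M _ _ (c s2) (B _ _ (M _ _ gc cc) (M _ _ dc sc))).
- exact: (M _ _ (c (s1 * s2)) (B _ _ (M _ _ epc cc) (M _ _ zc sc))).
- exact: (M _ _ (c s2) (D _ _ (M _ _ gc sc) (M _ _ dc cc))).
- exact: (M _ _ (c (s1 * s2)) (D _ _ (M _ _ epc sc) (M _ _ zc cc))).
Qed.

(** The class is a union of images of lines through the origin of the parameter space, all
    containing [chart (fun=> 0)]. *)
Lemma connected_sign_class : connected (sign_class s1 s2).
Proof.
pose ray (q : nat -> R) (t : R) := chart (fun i => t * q i).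
have ray0 q : ray q 0 = chart (fun=> 0).
  by congr chart; apply/funext => i; rewrite mul0r.
have ray1 q : ray q 1 = chart q.
  by congr chart; apply/funext => i; rewrite mul1r.
have -> : sign_class s1 s2 = \bigcup_q range (ray q).
  apply/seteqP; split=> [A /sign_class_chart[q ->]|_ [q _ [t _ <-]]].
    by exists q; [|exists 1; [|exact: ray1]].
  exact: chart_sign_class.
apply: bigcup_connected.
  by exists (chart (fun=> 0)) => q _; exists 0; [|exact: ray0].
move=> q _; apply: connected_continuous_connected.
  by apply/connected_intervalP => x y.
apply: continuous_subspaceT.
have tqc i : continuous (fun t : R => t * q i).
  by apply: continuous_mul; [move=> t; exact: cvg_id|exact: cst_continuous].
exact: (continuous_chart tqc).
Qed.

End Frame.

(** The hyperdeterminant is invariant under exchanging the first and third indices. *)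
Lemma hyperdet_slice3 A : hyperdet A =
  (A (0, 0, 0) * A (1, 1, 1) + A (0, 0, 1) * A (1, 1, 0)
   - A (0, 1, 0) * A (1, 0, 1) - A (1, 0, 0) * A (0, 1, 1)) ^+ 2
  - 4 * slice3_det A * (A (0, 0, 1) * A (1, 1, 1) - A (1, 0, 1) * A (0, 1, 1)).
Proof. by rewrite /hyperdet /slice1_det /slice3_det; ring. Qed.

(** If the slice determinant vanished, the hyperdeterminant would be a square. *)
Lemma slice1_det_neq0 A : hyperdet A < 0 -> slice1_det A != 0.
Proof.
apply: contraTneq => A1; rewrite -leNgt /hyperdet A1.
by rewrite mulr0 mul0r subr0 sqr_ge0.
Qed.

Lemma slice3_det_neq0 A : hyperdet A < 0 -> slice3_det A != 0.
Proof.
apply: contraTneq => A3; rewrite -leNgt hyperdet_slice3 A3.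
by rewrite mulr0 mul0r subr0 sqr_ge0.
Qed.

Lemma sign_mul_gt0 (b : bool) (x : R) : x != 0 ->
  (0 < (-1) ^+ b * x) = (b == (x < 0)).
Proof.
move=> x0; case: b; rewrite ?expr1 ?expr0 ?mulN1r ?mul1r ?oppr_gt0.
  by case: (x < 0).
by rewrite lt0r x0/= leNgt; case: (x < 0).
Qed.

Lemma sign_class_sign (b1 b2 : bool) A :
  sign_class ((-1) ^+ b1) ((-1) ^+ b2) A <->
  [/\ hyperdet A < 0, b1 = (slice1_det A < 0) & b2 = (slice3_det A < 0)].
Proof.
split=> -[A0].
  by rewrite !sign_mul_gt0 ?slice1_det_neq0 ?slice3_det_neq0// => /eqP ? /eqP ?.
by move=> /eqP ? /eqP ?; split;
  rewrite ?sign_mul_gt0 ?slice1_det_neq0 ?slice3_det_neq0.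
Qed.

End SignClasses.

Theorem proposition4p9 (R : realType) :
  components [set A : hypermatrix R | border_rank A = 3%N] #= `I_4.
Proof.
(* The two binary digits of [k] encode the two signs. *)
pose F k := sign_class ((-1) ^+ odd k) ((-1) ^+ odd k./2) : set (hypermatrix R).
have sE (b : bool) : ((-1) ^+ b) ^+ 2 = 1 :> R by rewrite sqrr_sign.
apply: (@card_components_open_partition _ _ _ F).
- apply/seteqP; split=> [A /border_rank3P A0|A [k _ /sign_class_sign[A0 _ _]]];
    last exact/border_rank3P.
  pose b1 := slice1_det A < 0; pose b2 := slice3_det A < 0.
  exists (b1 + b2.*2)%N; first by case: b1; case: b2.
  by apply/sign_class_sign; rewrite -/b1 -/b2; split => //; case: b1; case: b2.
- move=> i j /= i4 j4 [A [/sign_class_sign[_ i1 i2] /sign_class_sign[_ j1 j2]]].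
  have odd1 : odd i = odd j by rewrite i1 j1.
  have odd2 : odd i./2 = odd j./2 by rewrite i2 j2.
  by case: i i4 odd1 odd2 {i1 i2} => [|[|[|[|]]]]//;
    case: j j4 {j1 j2} => [|[|[|[|]]]].
- move=> k _; split; first exact: open_sign_class.
    exact: connected_sign_class.
  by eexists; apply: (@chart_sign_class _ _ _ _ _ (fun=> 0)).
Qed.
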